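(* Let $1\le p<\infty$ and let $(w_t)_{t\in\mathbb N}$ be a sequence of positive real numbers such that $C_p(w)=\infty$. Let $T$ be an aperiodic measure-preserving transformation of a probability space $(X,\mu)$. Then there is a sequence $(a_n)_{n\ge1}$ of integers such that the maximal function of the averages $$w_t2^{-t}\sum_{n\le2^t}f(T^{a_n}x)$$ is not weak $(p,p)$, i.e. there is no constant $C>0$ such that $$\Big\|\sup_t w_t2^{-t}\sum_{n\le2^t}f(T^{a_n}x)\Big\|_{p,\infty}\le C\|f\|_p\quad\text{for all }f\in L^p(X,\mu),$$ and hence there exists an $f\in L^p(X,\mu)$ for which these averages diverge (as $t\to\infty$) almost everywhere.
   Context: For a measurable $f$ on $(X,\mu)$, $\|f\|_{p,\infty}=\sup_{y>0}y\cdot\mu\{x:|f(x)|\ge y\}^{1/p}$. For a sequence $w=(w_t)_{t\in\mathbb N}$ of positive reals, $\|w\|_{p,\infty}=\sup_{y>0}y\cdot|\{t:w_t\ge y\}|^{1/p}$, and $$C_1(w)=\sup_{y>0}\sum_t[y<w_t<2^ty]\,w_t,\qquad C_p(w)=\|w\|_{p,\infty}\ \text{ for }1<p<\infty,$$ where $[P]$ is $1$ if $P$ holds and $0$ otherwise. $T$ is aperiodic if $\mu\{x:T^nx=x\text{ for some }n\ge1\}=0$.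
   Formalization: The probability space is assumed countably separated (off a null set, countably many measurable sets separate points), as all standard/Lebesgue spaces are; for arbitrary spaces the claim fails, e.g. translation on the integers with the trivial sigma-algebra, w_t = 1, p = 2. *)

(* Defs.v *)
From HB Require Import structures.
From mathcomp Require Import all_boot all_order all_algebra.
From mathcomp Require Import all_classical all_reals all_analysis.

Set Implicit Arguments.
Unset Strict Implicit.
Unset Printing Implicit Defensive.

Import Order.TTheory GRing.Theory Num.Theory.
Import numFieldNormedType.Exports.

Local Open Scope classical_set_scope.
Local Open Scope ring_scope.

Section weak_norms.
Context {R : realType}.
Local Open Scope ereal_scope.

(* The argument is extended-real valued because the supremum of infinitely
   many averages may be infinite at some points. *)
Definition weak_Lnorm {d} {X : measurableType d}
    (mu : {measure set X -> \bar R}) (p : R) (g : X -> \bar R) : \bar R :=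
  ereal_sup [set y%:E * mu [set x | y%:E <= `|g x|] `^ p^-1 |
             y in [set y : R | (0 < y)%R]].

Definition weak_seq_norm (p : R) (w : nat -> R) : \bar R :=
  ereal_sup [set y%:E * counting [set t : nat | (y <= w t)%R] `^ p^-1 |
             y in [set y : R | (0 < y)%R]].

(* The index t = 0 never contributes to the sum: y < w 0 < 2 ^+ 0 * y is
   impossible. *)
Definition C1 (w : nat -> R) : \bar R :=
  ereal_sup [set \sum_(0 <= t <oo | (y < w t < 2 ^+ t * y)%R) (w t)%:E |
             y in [set y : R | (0 < y)%R]].

Definition Cp (p : R) (w : nat -> R) : \bar R :=
  if p == 1%R then C1 w else weak_seq_norm p w.

End weak_norms.

Section dynamics.
Context {R : realType} {d : measure_display} {X : measurableType d}.
Variable mu : {measure set X -> \bar R}.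

Definition measure_preserving (T : X -> X) : Prop :=
  measurable_fun [set: X] T /\
  forall A, measurable A -> mu (T @^-1` A) = mu A.

Definition aperiodic (T : X -> X) : Prop :=
  mu.-negligible [set x | exists2 n : nat, (1 <= n)%N & iter n T x = x].

(* Up to a null set, points are separated by countably many measurable sets.
   Every standard Borel probability space and every Lebesgue-Rokhlin space has
   this property.  It is what makes pointwise aperiodicity meaningful: over the
   trivial sigma-algebra on the integers, the translation by 1 has no periodic
   point, but every measurable real function is constant. *)
Definition countably_separated : Prop :=
  exists (N : set X) (E : nat -> set X),
    [/\ mu.-negligible N,
        forall k, measurable (E k) &
        forall x y, ~ N x -> ~ N y -> (forall k, E k x <-> E k y) -> x = y].

End dynamics.

(* The exponents are natural numbers, since T need not be invertible; a 0 is
   not used. *)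
Definition wavg {R : realType} {X : Type} (w : nat -> R) (T : X -> X)
    (a : nat -> nat) (f : X -> R) (t : nat) (x : X) : R :=
  w t * (2 ^+ t)^-1 * \sum_(1 <= n < (2 ^ t).+1) f (iter (a n) T x).

Definition wmaximal {R : realType} {X : Type} (w : nat -> R) (T : X -> X)
    (a : nat -> nat) (f : X -> R) (x : X) : \bar R :=
  ereal_sup [set (wavg w T a f t x)%:E | t in [set: nat]].

Definition maximal_weak_type {R : realType} {d} {X : measurableType d}
    (mu : {measure set X -> \bar R}) (p : R) (w : nat -> R) (T : X -> X)
    (a : nat -> nat) : Prop :=
  exists2 C : R, 0 < C &
    forall f : X -> R, f \in Lfun mu p%:E ->
      (weak_Lnorm mu p (wmaximal w T a f) <= C%:E * 'N[mu]_p%:E[EFin \o f])%E.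

(* Main.v *)
Require Import Defs.
From HB Require Import structures.
From mathcomp Require Import all_boot all_order all_algebra.
From mathcomp Require Import all_classical all_reals all_analysis.
From mathcomp Require Import measurable_realfun.
From mathcomp Require Import zify ring lra.

(** A nonnegative f in L^p is built whose averages are unbounded at almost
    every point.  Both conclusions follow: an unbounded sequence diverges, and
    a weak (p,p) inequality would force the maximal function of f to be finite
    almost everywhere.

    The exponents a_n may be prescribed independently on the dyadic blocks
    2^(t-1) < n <= 2^t.  Suppose that mu E <= 1/N while the preimages of E
    under T^0, ..., T^(N-1) cover most of X; such an E is given by a Rokhlin
    lemma ([rokhlin]).  Hand out consecutive disjoint intervals of exponents
    below N to the blocks, r_t of them to the block t, and repeat each exponent
    about 2^(t-1) / r_t times inside the block.  If T^k x lies in E for some k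
    in the interval of t, then the t-th average of h 1_E at x is at least
    w_t h / (4 r_t) ([block_average]).  As soon as y r_t <= w_t and N is the
    sum of the r_t, the maximal average is therefore at least y h / 4 on most
    of X, whereas the p-th power of the norm of h 1_E is at most h^p / N.
    So one looks for windows of scales t on which y^p N is large.

    Such windows exist beyond any given scale, and this is what C_p(w) = oo
    provides ([heavy_levels]).  For p > 1 one takes r_t = 1 when w_t >= y.  For
    p = 1 one takes r_t comparable to w_t / y, which leaves room in a block of
    length 2^(t-1) only if w_t is below about 2^t y: hence the truncation
    in C_1.

    Successive disjoint windows give functions h_i 1_(E_i) with summable p-th
    powers of norms whose maximal averages are at least i outside a set of
    measure 2^-i.  The function f is the l^p sum of the h_i 1_(E_i), which
    dominates each of them ([Lp_majorant]).

    For the Rokhlin lemma, countable separation and aperiodicity make it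
    possible to cover almost all of X by countably many sets that are disjoint
    from their first m - 1 preimages; merging finitely many of them
    ([separated_merge]) gives such a set A that is visited by most orbits.  The tower is read off the first
    visit time to A.  Since T may fail to be invertible, only preimages of sets
    are taken. *)

Set Implicit Arguments.
Unset Strict Implicit.
Unset Printing Implicit Defensive.

Import Order.TTheory GRing.Theory Num.Theory.
Import numFieldNormedType.Exports.

Local Open Scope classical_set_scope.
Local Open Scope ring_scope.

(** * Separated sets and the Rokhlin lemma *)

Section separated_sets.
Context {d : measure_display} {X : measurableType d}.
Variable T : X -> X.
Hypothesis mT : measurable_fun [set: X] T.

Lemma measurable_fun_iter n : measurable_fun [set: X] (iter n T).
Proof.
elim: n => [|n IH]; first exact: measurable_id.
exact: measurableT_comp.
Qed.

Lemma measurable_preimage_iter n A :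
  measurable A -> measurable (iter n T @^-1` A).
Proof.
by move=> mA; rewrite -[_ @^-1` _]setTI; exact: measurable_fun_iter.
Qed.

Definition separated (m : nat) (A : set X) : Prop :=
  forall i x, (0 < i < m)%N -> A x -> ~ A (iter i T x).

(** Dropping from B the points that reach A within m steps, and from A those
    that reach what is left of B within m steps, makes the union separated.
    Every dropped point still reaches the union, if only later; so the orbits
    that visit A or start in B are not lost.  The delay grows when the
    construction is iterated, but a visit at any finite time is enough for the
    Rokhlin tower. *)
Lemma separated_merge m A B :
  measurable A -> measurable B -> separated m A -> separated m B ->
  exists C, [/\ measurable C, separated m C,
    forall x, B x -> exists k, C (iter k T x) &
    forall x, (exists k, A (iter k T x)) -> exists k, C (iter k T x)].
Proof.
move=> mA mB sA sB.
pose B' := B `\` \bigcup_(i < m) (iter i T @^-1` A).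
pose A' := A `\` \bigcup_(i in [set i | (0 < i < m)%N]) (iter i T @^-1` B').
have mB' : measurable B'.
  apply: measurableD => //; apply: bigcup_measurable => i _.
  exact: measurable_preimage_iter.
have AB x : A x -> exists k, (B' `|` A') (iter k T x).
  move=> Ax; have [[i i0m B'x]|nB'] := pselect
    ((\bigcup_(i in [set i | (0 < i < m)%N]) (iter i T @^-1` B')) x).
    by exists i; left.
  by exists 0%N; right.
have AB2 x : (exists k, A (iter k T x)) -> exists k, (B' `|` A') (iter k T x).
  by move=> [k /AB[j]]; rewrite -iterD => ?; exists (j + k)%N.
exists (B' `|` A'); split => //.
- apply: measurableU => //; apply: measurableD => //.
  by apply: bigcup_measurable => i _; exact: measurable_preimage_iter.
- move=> i x i0m [[Bx nAx]|[Ax nBx]] [[By nAy]|[Ay nBy]].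
  + exact: sB By.
  + by apply: nAx; exists i => //=; case/andP: i0m.
  + by apply: nBx; exists i => //=.
  + exact: sA Ay.
- move=> x Bx; have [[i im Ax]|nAx] := pselect
    ((\bigcup_(i < m) (iter i T @^-1` A)) x).
    by apply: AB2; exists i.
  by exists 0%N; left.
Qed.

Lemma separated_merge_seq (I : eqType) m (B : I -> set X) (s : seq I) :
  (forall i, measurable (B i)) -> (forall i, separated m (B i)) ->
  exists A, [/\ measurable A, separated m A &
    forall i x, i \in s -> B i x -> exists k, A (iter k T x)].
Proof.
move=> mB sB; elim: s => [|i s [A [mA sA hA]]].
  by exists set0; split => //; move=> ? ? ? [].
have [C [mC sC hB hC]] := separated_merge mA (mB i) sA (sB i).
exists C; split => // j x; rewrite inE => /predU1P[->|js] Bx; first exact: hB.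
by apply: hC; exact: hA js Bx.
Qed.

End separated_sets.

Section rokhlin.
Context {R : realType} {d : measure_display} {X : measurableType d}.
Variables (mu : probability X R) (T : X -> X).
Hypothesis mpT : measure_preserving mu T.
Local Open Scope ereal_scope.

Lemma measure_preimage_iter n A :
  measurable A -> mu (iter n T @^-1` A) = mu A.
Proof.
move=> mA; elim: n => [//|n IH].
have [mT pT] := mpT; rewrite -[RHS]IH -(pT (iter n T @^-1` A)).
  by congr (mu _); apply/seteqP; split=> x /=; rewrite -iterSr.
exact: measurable_preimage_iter.
Qed.

Lemma negligible_preimage_iter n N :
  mu.-negligible N -> mu.-negligible (iter n T @^-1` N).
Proof.
move=> [A [mA A0 NA]]; exists (iter n T @^-1` A); split.
- by apply: measurable_preimage_iter => //; case: mpT.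
- by rewrite measure_preimage_iter.
- by move=> x /NA.
Qed.

Lemma separated_measure m A :
  measurable A -> separated T m A -> m%:R%:E * mu A <= 1.
Proof.
move=> mA sA.
have mTi n : measurable (iter n T @^-1` A).
  by apply: measurable_preimage_iter => //; case: mpT.
have lt_disj i j x : (i < j)%N -> (j < m)%N ->
    A (iter i T x) -> A (iter j T x) -> False.
  move=> ij jm Ai; rewrite -(subnK (ltnW ij)) iterD; apply: sA Ai.
  by rewrite subn_gt0 ij (leq_ltn_trans _ jm)// leq_subr.
have -> : m%:R%:E * mu A = mu (\big[setU/set0]_(i < m) (iter i T @^-1` A)).
  rewrite (@measure_bigsetU_ord _ _ _ mu m predT (fun i : 'I_m => iter i T @^-1` A)).
  - rewrite (eq_bigr (fun=> mu A)); last by move=> i _; exact: measure_preimage_iter.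
    have fA : mu A \is a fin_num by exact: fin_num_measure.
    by rewrite -(fineK fA) sumEFin sumr_const card_ord -EFinM mulr_natl.
  - by move=> i; exact: mTi.
  - move=> i j _ _ [x [/= Ai Aj]]; apply/val_inj/eqP.
    case: (ltngtP i j) => // ij; exfalso.
      exact: (lt_disj i j x ij).
    exact: (lt_disj j i x ij).
exact/probability_le1/bigsetU_measurable.
Qed.


(** At resolution K, a point is described by its pattern of membership in
    E 0, ..., E K.-1.  A point x whose iterates T x, ..., T^(m-1) x
    all have patterns other than its own lies in a separated set attached to
    its pattern.  Almost every point is of this kind for K large, since
    finitely many of the E k distinguish it from these iterates. *)
Lemma sweeping_separated m (e : R) : (0 < m)%N -> (0 < e)%R ->
  countably_separated mu -> aperiodic mu T ->
  exists A, exists2 G : set X, [/\ measurable A, separated T m A,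
    measurable G & mu (~` G) <= e%:E] &
    forall x, G x -> exists k, A (iter k T x).
Proof.
move=> m0 e0 [N [E [nN mE sepE]]] apT.
have mT : measurable_fun [set: X] T by case: mpT.
have [Z [mZ Z0 NZ]] : mu.-negligible (\bigcup_i (iter i T @^-1` N) `|`
    [set x | exists2 n : nat, (1 <= n)%N & iter n T x = x]).
  apply: negligibleU => //; apply: negligible_bigcup => k.
  exact: negligible_preimage_iter.
pose code K x : {ffun 'I_K -> bool} := [ffun k : 'I_K => `[< E k x >]].
have mcode K s : measurable [set x | code K x = s].
  have -> : [set x | code K x = s] =
      \bigcap_(k in [set: 'I_K]) [set x | `[< E k x >] = s k].
    apply/seteqP; split=> [x <- k _ /=|x h]; first by rewrite ffunE.
    by apply/ffunP => k; rewrite ffunE; exact: h.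
  apply: fin_bigcap_measurable => [|k _]; first exact: finite_finset.
  case: (s k).
    have -> : [set x | `[< E k x >] = true] = E k; last by [].
    by apply/seteqP; split=> x /= /asboolP.
  have -> : [set x | `[< E k x >] = false] = ~` E k; last exact: measurableC.
  by apply/seteqP; split=> x /= => [/negbT/asboolPn|/asboolPn/negbTE].
pose B K s := [set x | code K x = s] `\`
  \bigcup_(i in [set i | (0 < i < m)%N]) (iter i T @^-1` [set x | code K x = s]).
have mB K s : measurable (B K s).
  apply: measurableD => //; apply: bigcup_measurable => i _.
  exact: measurable_preimage_iter.
have sB K s : separated T m (B K s).
  by move=> i x im [_ nx] [ix _]; apply: nx; exists i.
pose G K := \big[setU/set0]_(s : {ffun 'I_K -> bool}) B K s.
have mG K : measurable (G K) by apply: bigsetU_measurable => s _.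
have GE K x : G K x <-> forall i, (0 < i < m)%N -> code K (iter i T x) <> code K x.
  rewrite /G -bigcup_seq; split=> [[s _ [/= <- nx]] i im ix|h].
    by apply: nx; exists i.
  exists (code K x); first by rewrite /= mem_index_enum.
  by split => //= -[i im /=]; exact: h.
have codeS K L x y : (K <= L)%N -> code L x = code L y -> code K x = code K y.
  move=> KL /ffunP h; apply/ffunP => k; rewrite !ffunE.
  by have := h (widen_ord KL k); rewrite !ffunE.
have ndG : {homo G : n k / (n <= k)%N >-> (n <= k)%O}.
  move=> K L KL; apply/subsetPset => x /GE h; apply/GE => i im ix.
  by apply: (h i im); exact: codeS KL ix.
have ZG : ~` Z `<=` \bigcup_K G K.
  move=> x Zx.
  have Nx j : ~ N (iter j T x) by move=> Nj; apply: Zx; apply: NZ; left; exists j.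
  have sx i : exists K, (0 < i < m)%N -> code K (iter i T x) <> code K x.
    have [im|] := boolP (0 < i < m)%N; last by exists 0%N.
    apply: contrapT => /forallNP h; apply: Zx; apply: NZ; right.
    exists i; first by case/andP: im.
    apply: sepE; [exact: Nx|exact: (Nx 0%N)|move=> k].
    have /not_implyP[_ /contrapT/ffunP/(_ (Ordinal (ltnSn k)))] := h k.+1.
    by rewrite !ffunE => hk; exact: asbool_eq_equiv hk.
  have [K hK] := choice sx.
  exists (\max_(i < m) K i) => //; apply/GE => i im ix.
  have im' : (i < m)%N by case/andP: im.
  by apply: (hK i im); apply: codeS ix; exact: (leq_bigmax (Ordinal im')).
have mUG : measurable (\bigcup_K G K) by exact: bigcupT_measurable.
have muUG : mu (\bigcup_K G K) = 1.
  apply/eqP; rewrite eq_le probability_le1//=.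
  have <- : mu (~` Z) = 1 by rewrite probability_setC// Z0 sube0.
  by rewrite le_measure// inE//; exact: measurableC.
have [K GK] : exists K, (1 - e)%:E <= mu (G K).
  apply: contrapT => /forallNP h.
  have cG := nondecreasing_cvg_mu (mu := mu) mG mUG ndG.
  have : limn (mu \o G) <= (1 - e)%:E.
    apply: lime_le; first exact: (cvgP _ cG).
    by apply: nearW => K /=; rewrite ltW// ltNge; exact/negP.
  have -> : limn (mu \o G) = 1 by rewrite -muUG; exact: cvg_lim cG.
  by rewrite lee_fin lerBrDl gerDr leNgt e0.
have [A [mA sA hA]] :=
  separated_merge_seq mT (index_enum {ffun 'I_K -> bool}) (mB K) (sB K).
exists A, (G K).
  split => //; rewrite probability_setC//.
  by rewrite leeBlDr ?fin_num_measure// addeC -leeBlDr// -EFinB.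
by move=> x; rewrite /G -bigcup_seq => -[s /= sK]; exact: hA.
Qed.

(** Take A separated at a scale m much larger than n, so that few points
    visit A within n steps.  The base of the tower consists of the points whose
    first visit to A occurs at a positive multiple of n; a point with first
    visit at time k >= n enters the base after k mod n steps. *)
Lemma rokhlin n (e : R) : (0 < n)%N -> (0 < e)%R ->
  countably_separated mu -> aperiodic mu T ->
  exists A, exists2 B : set X, [/\ measurable A, n%:R%:E * mu A <= 1,
    measurable B & mu B <= e%:E] &
    forall x, ~ B x -> exists2 i, (i < n)%N & A (iter i T x).
Proof.
move=> n0 e0 sepX apT.
have mT : measurable_fun [set: X] T by case: mpT.
(* This m makes n mu A <= n / m <= e / 2. *)
pose m := (Num.truncn (n%:R / (e / 2))%R).+1.
have nm : (n%:R <= m%:R * (e / 2))%R.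
  by rewrite -ler_pdivrMr ?divr_gt0// ltW// truncnS_gt.
have [A [G [mA sA mG GE] hA]] :=
  @sweeping_separated m (e / 2)%R isT (divr_gt0 e0 (ltr0Sn _ _)) sepX apT.
pose H k := iter k T @^-1` A `\` \bigcup_(j < k) (iter j T @^-1` A).
have mTA k : measurable (iter k T @^-1` A) by exact: measurable_preimage_iter.
have mH k : measurable (H k).
  by apply: measurableD => //; apply: bigcup_measurable.
have HE i k x : (i <= k)%N -> H k x -> H (k - i)%N (iter i T x).
  move=> ik [Ak nk]; split; first by rewrite /= -iterD subnK.
  move=> [j /= jk Aj]; apply: nk; exists (j + i)%N.
    by move: jk; rewrite /= ltn_subRL addnC.
  by rewrite /= iterD.
have Hinj k l x : H k x -> H l x -> k = l.
  move=> [Ak nk] [Al nl]; apply/eqP; rewrite eqn_leq; apply/andP; split.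
    by rewrite leqNgt; apply/negP => lk; apply: nk; exists l.
  by rewrite leqNgt; apply/negP => lk; apply: nl; exists k.
pose E := \bigcup_q H (q.+1 * n)%N.
have mE : measurable E by exact: bigcupT_measurable.
have sE : separated T n E.
  move=> i x /andP[i0 iN] [q _ Hq] [r _ Hr].
  have iq : (i <= q.+1 * n)%N by rewrite (leq_trans (ltnW iN))// leq_pmull.
  have {Hq Hr} qr := Hinj _ _ _ (HE _ _ _ iq Hq) Hr.
  have [rq|rq] := ltnP r q; first by have := leq_mul2r n r.+2 q.+1; lia.
  by have := leq_mul2r n q.+1 r.+1; lia.
exists E; exists (~` G `|` \bigcup_(i < n) (iter i T @^-1` A)); first split.
- by [].
- exact: separated_measure.
- by apply: measurableU; [exact: measurableC|exact: bigcup_measurable].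
- rewrite [X in (_ <= X%:E)%E](splitr e) EFinD.
  apply: (le_trans (measureU2 _ _ _));
    [exact: measurableC|exact: bigcup_measurable|].
  apply: leeD => //; rewrite bigcup_mkord.
  apply: (le_trans
    (@Boole_inequality _ _ _ mu (fun i => iter i T @^-1` A) n _)) => //.
  have fA : mu A \is a fin_num by exact: fin_num_measure.
  rewrite (eq_bigr (fun=> mu A)); last by move=> i _; exact: measure_preimage_iter.
  rewrite -(fineK fA) sumEFin sumr_const card_ord lee_fin /= -[leLHS]mulr_natl.
  have := separated_measure mA sA; rewrite -(fineK fA) -EFinM lee_fin => mA1.
  have A0 : (0 <= fine (mu A))%R by rewrite fine_ge0.
  by rewrite (le_trans (ler_wpM2r A0 nm))// mulrAC ler_piMl// divr_ge0// ltW.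
- move=> x /not_orP[/contrapT Gx nA].
  have exk : exists k, `[< A (iter k T x) >].
    by have [k Ak] := hA _ Gx; exists k; exact/asboolP.
  case: (ex_minnP exk) => k /asboolP Ak mink.
  have Hk : H k x.
    by split => // -[j /= jk /asboolP/mink]; rewrite leqNgt jk.
  have nk : (n <= k)%N.
    by rewrite leqNgt; apply/negP => kn; apply: nA; exists k.
  have rk : (k %% n <= k)%N by rewrite leq_mod.
  exists (k %% n)%N; first by rewrite ltn_mod.
  exists (k %/ n).-1 => //; rewrite prednK ?divn_gt0//.
  have := HE _ _ _ rk Hk; congr (H _ _); lia.
Qed.

End rokhlin.

(** * Windows of scales on which the weights are heavy *)

Section heavy_levels.
Context {R : realType}.

Lemma heavy_window (u : nat -> R) (m : nat) (B : R) :
  (forall t, 0 <= u t) -> (B%:E < \sum_(0 <= t <oo) (u t)%:E)%E ->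
  exists2 m', (m < m')%N & B - \sum_(0 <= t < m) u t <= \sum_(m <= t < m') u t.
Proof.
move=> u0 Bu.
have [M BM] : exists M, B <= \sum_(0 <= t < M) u t.
  apply: contrapT => /forallNP h; move: Bu; apply/negP; rewrite -leNgt.
  apply: lime_le; first by apply: is_cvg_nneseries => n _ _; rewrite lee_fin.
  apply: nearW => M; rewrite sumEFin lee_fin ltW// ltNge; exact/negP.
exists (maxn M m.+1); first by rewrite leq_max ltnSn orbT.
rewrite lerBlDl -big_cat_nat ?leq0n//=; last by rewrite leq_max leqnSn orbT.
rewrite (le_trans BM)// [leRHS](big_cat_nat (n := M)) ?leq_maxl//=.
by rewrite lerDl sumr_ge0.
Qed.

(** The finitely many scales below m cost only a bounded amount: at most the
    sum of the w t for p = 1 and of the (w t) ^ p for p > 1, uniformly in the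
    level y.  That amount is added to the bound asked of the whole sequence. *)
Lemma heavy_levels (p : R) (w : nat -> R) (m : nat) (K : R) :
  1 <= p -> (forall t, 0 < w t) -> Cp p w = +oo%E -> (0 < m)%N ->
  exists y m' (r : nat -> nat), [/\ 0 < y, (m < m')%N,
    forall t, (m <= t < m')%N -> (r t <= 2 ^ t.-1)%N /\ y * (r t)%:R <= w t &
    K <= y `^ p * (\sum_(m <= t < m') r t)%:R].
Proof.
move=> p1 w0; rewrite /Cp; case: eqVneq => [->|pN1] Cw m0.
  pose B := 2 * K + \sum_(0 <= t < m) w t.
  have /ereal_sup_gt[_ [y /= y0 <-]] : (B%:E < C1 w)%E by rewrite Cw ltry.
  rewrite eseries_mkcond.
  pose u t := if y < w t < 2 ^+ t * y then w t else 0.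
  have -> : \big[+%E/0%E]_(0 <= t <oo)
      (if y < w t < 2 ^+ t * y then (w t)%:E else 0%E)
    = (\sum_(0 <= t <oo) (u t)%:E)%E.
    by apply: eq_eseriesr => t _; rewrite /u; case: ifP.
  have u0 t : 0 <= u t by rewrite /u; case: ifP => // _; rewrite ltW.
  move=> /(heavy_window m u0)[m' mm' Bm'].
  pose r t := if y < w t < 2 ^+ t * y
    then minn (Num.truncn (w t / y)) (2 ^ t.-1) else 0%N.
  exists y, m', r; split => //.
    move=> t _; rewrite /r; case: ifP => [/andP[yw _]|_]; last by rewrite mulr0 ltW.
    split; first exact: geq_minr.
    rewrite mulrC -ler_pdivlMr// (@le_trans _ _ (Num.truncn (w t / y))%:R)//.
      by rewrite ler_nat geq_minl.
    by rewrite truncn_le divr_ge0// ltW.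
  rewrite powRr1 ?(ltW y0)// natr_sum mulr_sumr.
  have K2 : 2 * K <= \sum_(m <= t < m') u t.
    apply: le_trans Bm'; rewrite /B -addrA lerDl subr_ge0.
    by apply: ler_sum => t _; rewrite /u; case: ifP => // _; rewrite ltW.
  (* Neither the integer part nor the cap at 2 ^ t.-1 loses more than a factor 2,
     since 1 < w t / y < 2 ^ t. *)
  suff : \sum_(m <= t < m') u t <= 2 * \sum_(m <= t < m') y * (r t)%:R.
    by move=> /(le_trans K2); rewrite ler_pM2l.
  rewrite mulr_sumr big_nat [leRHS]big_nat; apply: ler_sum => t /andP[mt _].
  rewrite /u /r; case: ifP => [/andP[yw wy]|_]; last by rewrite mulr0 mulr0.
  rewrite mulrCA -ler_pdivrMl// mulrC.
  have [_|_] := leqP.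
    have w1 : 1 <= w t / y by rewrite ler_pdivlMr// mul1r ltW.
    have t1 : (1 <= Num.truncn (w t / y))%N by rewrite truncn_gt0.
    apply: (le_trans (ltW (truncnS_gt _))).
    by rewrite -natrM ler_nat mul2n -addnn -addn1 leq_add2l.
  rewrite ler_pdivrMr// -natrM -expnS prednK ?(leq_trans m0)//.
  by rewrite natrX ltW.
have p0 : 0 < p by rewrite (lt_le_trans _ p1).
pose B := `|K| + \sum_(0 <= t < m) w t `^ p.
have B0 : 0 <= B by rewrite addr_ge0// sumr_ge0// => t _; rewrite powR_ge0.
have /ereal_sup_gt[_ [y /= y0 <-]] : ((B `^ p^-1)%:E < weak_seq_norm p w)%E.
  by rewrite Cw ltry.
set A := [set t | y <= w t] => BA.
have yp0 : 0 < y `^ p by rewrite powR_gt0.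
pose u t := y `^ p * (y <= w t)%R%:R.
have u0 t : 0 <= u t by rewrite mulr_ge0// ltW.
have {BA} : (B%:E < \sum_(0 <= t <oo) (u t)%:E)%E.
  rewrite (_ : \big[+%E/0%E]_(0 <= t <oo) (u t)%:E =
      (y `^ p)%:E * counting A)%E; last first.
    rewrite counting_dirac -nneseriesZl//; apply: eq_eseriesr => t _.
    rewrite /u EFinM diracE; congr (_ * (_%:R)%:E)%E.
    case: (boolP (y <= w t)) => yw; first by rewrite mem_set.
    by rewrite memNset//; exact/negP.
  rewrite ltNge; apply/negP; rewrite muleC -lee_pdivlMr// => cA.
  have c0 : (0 <= counting A :> \bar R)%E by exact: measure_ge0.
  move: BA; apply/negP; rewrite -leNgt muleC -lee_pdivlMr//.
  have pV0 : 0 <= p^-1 by rewrite invr_ge0 ltW.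
  apply: (le_trans (gt0_ler_poweR pV0 _ _ cA)); rewrite ?in_itv/= ?leey ?andbT//.
    by rewrite mule_ge0 ?lee_fin// invr_ge0 ltW.
  rewrite -EFinM lee_fin powRM ?invr_ge0 ?(ltW yp0)//.
  by rewrite -powRN -powRrM mulNr mulfV ?gt_eqF// powR_inv1// ltW.
move=> /(heavy_window m u0)[m' mm' Bm'].
exists y, m', (fun t => nat_of_bool (y <= w t)%R); split => //.
  move=> t _; split; first by rewrite (leq_trans (leq_b1 _))// expn_gt0.
  by case: (leP y (w t)) => yw; rewrite ?mulr1 ?mulr0// ltW.
rewrite natr_sum mulr_sumr (le_trans (ler_norm _))// (le_trans _ Bm')//.
rewrite /B -addrA lerDl subr_ge0; apply: ler_sum => t _; rewrite /u.
case: (leP y (w t)) => yw; rewrite ?mulr1 ?mulr0 ?powR_ge0//.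
by apply: ge0_ler_powR => //; rewrite ?nnegrE ltW.
Qed.

End heavy_levels.

(** * Exponents on dyadic blocks *)

Lemma sum_nat_locate (r : nat -> nat) (m m' k : nat) :
  (k < \sum_(m <= t < m') r t)%N ->
  exists2 t, (m <= t < m')%N &
    (\sum_(m <= s < t) r s <= k < \sum_(m <= s < t) r s + r t)%N.
Proof.
elim: m' => [|m' IH]; first by rewrite big_geq.
have [mm'|m'm] := leqP m m'; last by rewrite big_geq.
rewrite big_nat_recr//= => km.
have [/IH[t tm kt]|km'] := ltnP k (\sum_(m <= t < m') r t).
  by exists t => //; lia.
by exists m'; [rewrite mm'/=|rewrite km' km].
Qed.

(** The exponent attached to n in the block t = up_log 2 n: the exponents from
    the sum of the r s, m <= s < t, onwards are listed in order, each repeated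
    2 ^ t.-1 %/ r t times. *)
Definition spread_index (r : nat -> nat) (m n : nat) : nat :=
  let t := up_log 2 n in
  \sum_(m <= s < t) r s + (n - (2 ^ t.-1).+1) %/ (2 ^ t.-1 %/ r t).

Lemma spread_index_const (r : nat -> nat) (m t j n : nat) :
  (0 < t)%N -> (r t <= 2 ^ t.-1)%N -> (j < r t)%N ->
  let q := (2 ^ t.-1 %/ r t)%N in
  ((2 ^ t.-1).+1 + j * q <= n < (2 ^ t.-1).+1 + j * q + q)%N ->
  spread_index r m n = (\sum_(m <= s < t) r s + j)%N.
Proof.
move=> t0 rt jr q /andP[n1 n2].
have rq : (r t * q <= 2 ^ t.-1)%N by rewrite mulnC leq_trunc_div.
have jq : (j * q + q <= r t * q)%N by rewrite -mulSnr leq_mul2r jr orbT.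
have nt : up_log 2 n = t.
  rewrite -(prednK t0); apply: up_log_eq => //; rewrite expnS; lia.
rewrite /spread_index nt -/q; congr addn.
have q0 : (0 < q)%N by rewrite /q divn_gt0//; lia.
have -> : (n - (2 ^ t.-1).+1 = j * q + (n - (2 ^ t.-1).+1 - j * q))%N by lia.
rewrite divnMDl// divn_small ?addn0//; lia.
Qed.

(** The windows M i <= _ < M i.+1 are disjoint, so the prescriptions b i do not
    conflict. *)
Lemma glue_windows (M : nat -> nat) (b : nat -> nat -> nat) (l : nat -> nat) :
  (forall i, M i < M i.+1)%N ->
  exists a : nat -> nat, forall i n, (M i <= l n < M i.+1)%N -> a n = b i n.
Proof.
move=> Mlt.
have Mle : {homo M : i j / (i <= j)%N}.
  by apply: homo_leq => // [i j k|i]; [exact: leq_trans|exact: ltnW].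
suff /choice[a ha] : forall n, exists v,
    forall i, (M i <= l n < M i.+1)%N -> v = b i n.
  by exists a => i n; exact: ha.
move=> n; have [[i /andP[i1 i2]]|h] := pselect (exists i, (M i <= l n < M i.+1)%N).
  exists (b i n) => j /andP[j1 j2]; congr (b _ n).
  have [ij|ji|//] := ltngtP i j.
  - by have := Mle _ _ ij; lia.
  - by have := Mle _ _ ji; lia.
by exists 0%N => i hi; exfalso; apply: h; exists i.
Qed.

(** * Lp sums of multiples of indicator functions *)

Section majorant.
Context {R : realType} {d : measure_display} {X : measurableType d}.
Variable mu : probability X R.
Local Open Scope ereal_scope.

(** The l^p sum f = (sum of the (h_i 1_(E_i))^p)^(1/p): the integral of f^p is
    the sum of the h_i^p mu (E_i), and f is at least each h_i 1_(E_i) wherever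
    the sum is finite.  The value of f where it is infinite is 0, an artefact
    of [fine], whence the restriction to almost every x. *)
Lemma Lp_majorant (p : R) (h : nat -> R) (E : nat -> set X) (c : nat -> R) :
  (1 <= p)%R -> (forall i, 0 <= h i)%R -> (forall i, measurable (E i)) ->
  (forall i, (h i `^ p)%:E * mu (E i) <= (c i)%:E) ->
  \sum_(0 <= i <oo) (c i)%:E < +oo ->
  exists f : X -> R, [/\ f \in Lfun mu p%:E, forall x, (0 <= f x)%R &
    {ae mu, forall x, forall i, (h i * \1_(E i) x <= f x)%R}].
Proof.
move=> p1 h0 mE hc csum.
have p0 : (0 < p)%R by rewrite (lt_le_trans _ p1).
pose u i x : \bar R := (h i `^ p)%:E * (\1_(E i) x)%:E.
pose g x : \bar R := \sum_(0 <= i <oo) u i x.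
have t0 i x : 0 <= u i x by rewrite mule_ge0// lee_fin ?powR_ge0.
have mI i : measurable_fun [set: X] (EFin \o (\1_(E i) : X -> R)).
  by apply/measurable_EFinP; exact: measurable_indic.
have mterm i : measurable_fun [set: X] (u i) by apply: measurable_funeM; exact: mI.
have g0 x : 0 <= g x by exact: nneseries_ge0.
have mg : measurable_fun [set: X] g.
  exact: (@ge0_emeasurable_sum _ _ _ setT u predT).
have ig : \int[mu]_x g x < +oo.
  rewrite (integral_nneseries _ measurableT mterm)//; apply: le_lt_trans csum.
  apply: lee_nneseries.
    by move=> i _ _; apply: integral_ge0.
  move=> i _; rewrite ge0_integralZl_EFin ?powR_ge0//.
    by rewrite integral_indic// setIT.
  exact: mI.
have intg : mu.-integrable [set: X] g.
  apply/integrableP; split => //.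
  by under eq_integral do rewrite gee0_abs//.
pose f x := (fine (g x) `^ p^-1)%R.
exists f; split.
- have mfg : measurable_fun [set: X] (fine \o g).
    exact: (measurableT_comp (fine_measurable measurableT)).
  have mf : measurable_fun [set: X] f.
    exact: (measurableT_comp (measurable_powR p^-1)).
  rewrite inE; apply/andP; split; first by rewrite inE/=.
  rewrite inE/= /finite_norm unlock poweR_lty//.
  have fE x : `|(EFin \o f) x| `^ p = (EFin \o (fine \o g)) x.
    rewrite gee0_abs /= ?lee_fin ?powR_ge0// /f.
    by rewrite -powRrM mulVf ?gt_eqF// powRr1 ?fine_ge0.
  under eq_integral do rewrite fE.
  apply: le_lt_trans ig; apply: ge0_le_integral => //.
  - by move=> x _; rewrite /= lee_fin fine_ge0.
  - exact/measurable_EFinP.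
  - by move=> x _ /=; have := g0 x; case: (g x) => // _; exact: leey.
- by move=> x; exact: powR_ge0.
- have := integrable_ae measurableT intg; apply: filterS => x /(_ I) gx i.
  have hg : ((h i `^ p) * \1_(E i) x <= fine (g x))%R.
    rewrite -lee_fin fineK// EFinM.
    have := @nneseries_lim_ge _ (u^~ x) predT 0 i.+1.
    move=> /(_ (fun n _ _ => t0 n x)); apply: le_trans.
    by rewrite big_nat_recr//= leeDr// sume_ge0.
  move: hg; rewrite indicE; case: (x \in E i) => /=; last by rewrite !mulr0 powR_ge0.
  rewrite !mulr1 => hg; rewrite /f.
  have -> : h i = ((h i `^ p) `^ p^-1)%R.
    by rewrite -powRrM mulfV ?gt_eqF// powRr1.
  by apply: ge0_ler_powR hg; rewrite ?nnegrE ?invr_ge0 ?powR_ge0 ?fine_ge0 ?(ltW p0).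
Qed.

End majorant.

(** * Stages and their combination *)

Section stages.
Context {R : realType} {d : measure_display} {X : measurableType d}.
Variables (mu : probability X R) (p : R) (w : nat -> R) (T : X -> X).

(** Of the 2 ^ t.-1 indices of the block, at least a fraction 1 / (2 r_t)
    carries the exponent k; the block is half of the range of the average. *)
Lemma block_average (y h : R) (r : nat -> nat) (m t k : nat) (E : set X) x :
  0 < y -> 0 <= h -> (0 < t)%N -> (r t <= 2 ^ t.-1)%N -> y * (r t)%:R <= w t ->
  (\sum_(m <= s < t) r s <= k < \sum_(m <= s < t) r s + r t)%N ->
  E (iter k T x) ->
  y * h / 4 <= w t * (2 ^+ t)^-1 *
    \sum_((2 ^ t.-1).+1 <= n < (2 ^ t).+1) h * \1_E (iter (spread_index r m n) T x).
Proof.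
move=> y0 h0 t0 rt yr /andP[k1 k2] Ek.
set o := (\sum_(m <= s < t) r s)%N in k1 k2.
set j := (k - o)%N; have jr : (j < r t)%N by rewrite /j; lia.
(* q is the number of repetitions of k in the block. *)
set M := (2 ^ t.-1)%N in rt *; pose q := (M %/ r t)%N.
have r0 : (0 < r t)%N by lia.
have Mq : (M <= 2 * (r t * q))%N.
  have q0 : (0 < q)%N by rewrite divn_gt0.
  have := ltn_ceil M r0; rewrite -/q; nia.
have rq : (r t * q <= M)%N by rewrite mulnC leq_trunc_div.
have jq : (j * q + q <= r t * q)%N by rewrite -mulSnr leq_mul2r jr orbT.
have M2 : (2 ^ t = 2 * M)%N by rewrite /M -expnS prednK.
have F0 n : 0 <= h * \1_E (iter (spread_index r m n) T x) by rewrite mulr_ge0.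
have S1 : h * q%:R <=
    \sum_(M.+1 <= n < (2 ^ t).+1) h * \1_E (iter (spread_index r m n) T x).
  rewrite (big_cat_nat (n := (M.+1 + j * q)%N))/=; [|lia|lia].
  rewrite [X in _ + X](big_cat_nat (n := (M.+1 + j * q + q)%N))/=; [|lia|lia].
  rewrite -[leLHS]add0r lerD ?sumr_ge0// -[leLHS]addr0 lerD ?sumr_ge0//.
  rewrite big_nat (eq_bigr (fun=> h)).
    by rewrite -big_nat sumr_const_nat addKn mulr_natr.
  move=> n /andP[n1 n2].
  rewrite (@spread_index_const r m t j)//; last by rewrite -/M -/q n1.
  by rewrite -/o /j subnKC// indicE mem_set// mulr1.
have M0 : 0 < M%:R :> R by rewrite ltr0n; lia.
apply: (@le_trans _ _ (y * (r t)%:R * (2 * M%:R)^-1 * (h * q%:R))).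
  have MqR : M%:R <= 2 * ((r t)%:R * q%:R) :> R by rewrite -!natrM ler_nat.
  have -> : y * (r t)%:R * (2 * M%:R)^-1 * (h * q%:R) =
    y * h * ((r t)%:R * q%:R / (2 * M%:R)) by ring.
  rewrite ler_wpM2l ?mulr_ge0 ?(ltW y0)//.
  by rewrite ler_pdivlMr ?mulr_gt0//; lra.
have -> : 2 ^+ t = 2 * M%:R :> R by rewrite -natrX M2 natrM.
apply: ler_pM => //; rewrite ?mulr_ge0 ?invr_ge0 ?mulr_ge0 ?(ltW y0) ?(ltW M0)//.
by rewrite ler_wpM2r// invr_ge0 mulr_ge0 ?(ltW M0).
Qed.

(** Only the values of b on the blocks of the scales m <= t < m' matter here, so
    stages with disjoint windows can share a single sequence of exponents.  The
    integer i is at once the height to reach and the rate of decay, which makes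
    the h_i 1_(E_i) summable. *)
Definition stage (m m' i : nat) (b : nat -> nat) (h : R) (E B : set X) : Prop :=
  [/\ (m < m')%N, 0 <= h, measurable E & measurable B] /\
  [/\ ((h `^ p)%:E * mu E <= (2^-1 ^+ i)%:E)%E, (mu B <= (2^-1 ^+ i)%:E)%E &
    forall x, ~ B x -> exists2 t, (m <= t < m')%N &
      i%:R <= w t * (2 ^+ t)^-1 *
        \sum_((2 ^ t.-1).+1 <= n < (2 ^ t).+1) h * \1_E (iter (b n) T x)].

Hypotheses (p1 : 1 <= p) (w0 : forall t, 0 < w t) (Cw : Cp p w = +oo%E).
Hypotheses (sepX : countably_separated mu) (mpT : measure_preserving mu T).
Hypothesis (apT : aperiodic mu T).

Lemma exists_stage (m i : nat) : (0 < m)%N ->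
  exists m' (b : nat -> nat) (h : R) (E B : set X), stage m m' i b h E B.
Proof.
move=> m0.
have p0 : 0 < p by rewrite (lt_le_trans _ p1).
(* With h = 4 (i+1) / y, the lower bound y h / 4 is i+1, and h^p / N <= 2^-i
   amounts to c <= 2^-i y^p N. *)
pose c : R := (4 * i.+1%:R) `^ p.
have c0 : 0 < c by rewrite powR_gt0// mulr_gt0.
have e0 : 0 < 2^-1 ^+ i :> R by rewrite exprn_gt0// invr_gt0.
have [y [m' [r [y0 mm' hr Kr]]]] := heavy_levels (c / 2^-1 ^+ i) p1 w0 Cw m0.
set N := (\sum_(m <= t < m') r t)%N in Kr.
have yp0 : 0 < y `^ p by rewrite powR_gt0.
have N0 : (0 < N)%N.
  rewrite lt0n; apply/eqP => N0; move: Kr; rewrite N0 mulr0 leNgt.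
  by rewrite divr_gt0.
have [E [B [mE muE mB muB] hB]] := rokhlin mpT N0 e0 sepX apT.
have y4 : 0 <= 4 * i.+1%:R / y by rewrite divr_ge0 ?(ltW y0)// mulr_ge0.
exists m', (spread_index r m), (4 * i.+1%:R / y), E, B; split => //; split => //.
  have fE : mu E \is a fin_num by exact: fin_num_measure.
  move: muE; rewrite -(fineK fE) -!EFinM !lee_fin => muE.
  rewrite powRM ?invr_ge0 ?(ltW y0)// -/c.
  have -> : y^-1 `^ p = (y `^ p)^-1.
    by rewrite -[y^-1]powR_inv1 ?(ltW y0)// -powRrM mulN1r powRN.
  rewrite mulrAC ler_pdivrMr//.
  move: Kr; rewrite ler_pdivrMr// => Kr.
  have E0 : 0 <= fine (mu E) by rewrite fine_ge0.
  apply: (le_trans (ler_wpM2r E0 Kr)).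
  have -> : y `^ p * N%:R * 2^-1 ^+ i * fine (mu E) =
    2^-1 ^+ i * y `^ p * (N%:R * fine (mu E)) by ring.
  by rewrite ler_piMr// mulr_ge0// ltW.
move=> x /hB[k kN Ek]; have [t tm kt] := sum_nat_locate kN.
have [rt yr] := hr _ tm.
have t0 : (0 < t)%N by lia.
exists t => //; apply: le_trans (block_average y0 y4 t0 rt yr kt Ek).
have -> : y * (4 * i.+1%:R / y) / 4 = i.+1%:R by field; rewrite gt_eqF.
by rewrite ler_nat.
Qed.

Lemma exists_stages : exists (M : nat -> nat) (b : nat -> nat -> nat)
    (h : nat -> R) (E B : nat -> set X),
  forall i, (0 < M i)%N /\ stage (M i) (M i.+1) i (b i) (h i) (E i) (B i).
Proof.
pose St := (nat * (nat -> nat) * R * set X * set X)%type.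
have ex (mi : nat * nat) : exists s : St, (0 < mi.1)%N ->
    stage mi.1 s.1.1.1.1 mi.2 s.1.1.1.2 s.1.1.2 s.1.2 s.2.
  case: mi => m i /=.
  have [m0|] := ltnP 0 m; last by exists (0%N, id, 0, set0, set0).
  have [m' [b [h [E [B H]]]]] := exists_stage i m0.
  by exists (m', b, h, E, B).
have [g hg] := choice ex.
pose M := fix M i := if i is j.+1 then (g (M j, j)).1.1.1.1 else 1%N.
have M0 i : (0 < M i)%N.
  elim: i => // i IH; have [[/= MM _ _ _] _] := hg (M i, i) IH.
  exact: leq_ltn_trans MM.
exists M, (fun i => (g (M i, i)).1.1.1.2), (fun i => (g (M i, i)).1.1.2),
  (fun i => (g (M i, i)).1.2), (fun i => (g (M i, i)).2).
by move=> i; split; [exact: M0|exact: (hg (M i, i) (M0 i))].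
Qed.

(** A point is harmless if its orbit avoids the null set where f fails to
    dominate some h_i 1_(E_i), and if it is outside B i for infinitely many i;
    the points inside B i for all large i form a null set because
    mu (B i) <= 2^-i. *)
Lemma unbounded_averages : exists a : nat -> nat, exists2 f : X -> R,
  f \in Lfun mu p%:E &
  {ae mu, forall x, forall K : R, exists t, K <= wavg w T a f t x}.
Proof.
have [M [b [h [E [B HM]]]]] := exists_stages.
have M0 i : (0 < M i)%N by case: (HM i).
have Mlt i : (M i < M i.+1)%N by have [_ [[]]] := HM i.
have h0 i : 0 <= h i by have [_ [[]]] := HM i.
have mE i : measurable (E i) by have [_ [[]]] := HM i.
have mB i : measurable (B i) by have [_ [[]]] := HM i.
have hE i : ((h i `^ p)%:E * mu (E i) <= (2^-1 ^+ i)%:E)%E.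
  by have [_ [_ []]] := HM i.
have muB i : (mu (B i) <= (2^-1 ^+ i)%:E)%E.
  by have [_ [_ []]] := HM i.
have [a ha] : exists a : nat -> nat,
    forall i n, (M i <= up_log 2 n < M i.+1)%N -> a n = b i n.
  exact: glue_windows.
have sum2 : (\sum_(0 <= i <oo) (2^-1 ^+ i : R)%:E < +oo)%E.
  have := @epsilon_trick0 R 2 predT (ler0n _ _).
  move=> /le_lt_trans/(_ (ltry _)); apply: le_lt_trans.
  apply: lee_nneseries => i _ //.
  by rewrite lee_fin natrX exprS invfM mulrA divff// mul1r exprVn.
have [f [fL f0 fE]] := Lp_majorant p1 h0 mE hE sum2.
exists a; exists f => //.
have [Z [mZ Z0 fZ]] := fE.
have nZ : mu.-negligible (\bigcup_k (iter k T @^-1` Z)).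
  apply: negligible_bigcup => k; apply: negligible_preimage_iter => //.
  by exists Z; split.
have nB : mu.-negligible (\bigcup_j \bigcap_i B (j + i)%N).
  apply: negligible_bigcup => j.
  have mBj : measurable (\bigcap_i B (j + i)%N) by exact: bigcapT_measurable.
  apply/negligibleP => //; apply/eqP; rewrite eq_le measure_ge0 andbT.
  apply/lee_addgt0Pr => e e0; rewrite add0e.
  pose i := (Num.truncn e^-1).+1.
  apply: (@le_trans _ _ (mu (B (j + i)%N))).
    by apply: le_measure; rewrite ?inE//; exact: bigcap_inf.
  apply: (le_trans (muB _)); rewrite lee_fin exprVn invf_ple ?posrE ?exprn_gt0//.
  rewrite (le_trans (ltW (truncnS_gt _)))// -natrX ler_nat.
  by rewrite (leq_trans (leq_addl j i))// ltnW// ltn_expl.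
apply: negligibleS (negligibleU nZ nB) => x /= nx.
apply: contrapT => /not_orP[xZ xB].
apply: nx => K.
have [i [Ki Bi]] : exists i, K <= i%:R /\ ~ B i x.
  pose j := (Num.truncn K).+1; apply: contrapT => /forallNP h'.
  apply: xB; exists j => // i _; apply: contrapT => nBi.
  apply: (h' (j + i)%N); split => //.
  by rewrite (le_trans (ltW (truncnS_gt K)))// ler_nat leq_addr.
have [_ [_ [_ _ HB]]] := HM i; have [t tM iw] := HB x Bi.
have t0 : (0 < t)%N by have := M0 i; lia.
exists t; apply: (le_trans Ki); apply: (le_trans iw).
have t2 : (2 ^ t = 2 * 2 ^ t.-1)%N by rewrite -expnS prednK.
rewrite /wavg ler_wpM2l//; first by rewrite mulr_ge0 ?invr_ge0 ?exprn_ge0// ltW.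
rewrite [leRHS](big_cat_nat (n := (2 ^ t.-1).+1))//=; last by rewrite t2; lia.
rewrite -[leLHS]add0r lerD ?sumr_ge0//.
rewrite big_nat [leRHS]big_nat; apply: ler_sum => n /andP[n1 n2].
have -> : a n = b i n.
  apply: ha; suff -> : up_log 2 n = t by [].
  by rewrite -(prednK t0); apply: up_log_eq => //; rewrite (prednK t0) n1.
apply: contrapT => nf; apply: xZ; exists (b i n) => //=; apply: fZ => /= /(_ i).
exact: nf.
Qed.

End stages.

(** * Failure of convergence and of the weak type inequality *)

Lemma unbounded_not_cvgn (R : realType) (u : nat -> R) :
  (forall K, exists t, K <= u t) -> ~ cvgn u.
Proof.
move=> uK /cvg_seq_bounded[M [_ /(_ (M + 1))]]; rewrite ltrDl ltr01 => /(_ isT) hM.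
have [t] := uK (M + 2); have := hM t I => /=.
move=> /ler_normlP[_]; lra.
Qed.

Section weak_type_failure.
Context {R : realType} {d : measure_display} {X : measurableType d}.
Variables (mu : probability X R) (p : R) (w : nat -> R) (T : X -> X).

Lemma measurable_wmaximal (a : nat -> nat) (f : X -> R) :
  measurable_fun [set: X] T -> measurable_fun [set: X] f ->
  measurable_fun [set: X] (wmaximal w T a f).
Proof.
move=> mT mf.
have mw t : measurable_fun [set: X] (EFin \o wavg w T a f t).
  apply/measurable_EFinP; apply: measurable_funM; first exact: measurable_cst.
  apply: measurable_sum => n; apply: (measurableT_comp mf).
  exact: measurable_fun_iter.
have := @measurable_fun_esups _ _ _ _ (fun t => EFin \o wavg w T a f t) mw 0%N.
congr measurable_fun; apply/funext => x; rewrite /esups /wmaximal /=.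
by congr ereal_sup; apply/seteqP; split=> _ [t _ <-]; exists t.
Qed.

(** If every average is unbounded almost everywhere, then the maximal function
    is at least y on a set of full measure for each y, and its weak norm
    exceeds any constant. *)
Lemma unbounded_not_weak_type (a : nat -> nat) (f : X -> R) :
  0 < p -> measurable_fun [set: X] T -> f \in Lfun mu p%:E ->
  {ae mu, forall x, forall K : R, exists t, K <= wavg w T a f t x} ->
  ~ maximal_weak_type mu p w T a.
Proof.
move=> p0 mT fL fae [C C0 /(_ f fL)].
move: (fL); rewrite inE => /andP[]; rewrite !inE/= => mf fnorm.
have [Z [mZ Z0 fZ]] := fae.
apply/negP; rewrite -ltNge.
have Cf : (C%:E * 'N[mu]_p%:E[EFin \o f] \is a fin_num)%E.
  by rewrite fin_numM// ge0_fin_numE ?Lnorm_ge0.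
rewrite -(fineK Cf); set L := fine _.
pose y := `|L| + 1.
have y0 : 0 < y by rewrite ltr_pwDr.
have mg := measurable_wmaximal a mT mf.
have mS : measurable [set x | (y%:E <= `|wmaximal w T a f x|)%E].
  rewrite -[X in measurable X]setTI.
  apply: emeasurable_fun_c_infty => //; exact: measurableT_comp.
have muS : mu [set x | (y%:E <= `|wmaximal w T a f x|)%E] = 1%E.
  apply/eqP; rewrite eq_le probability_le1//=.
  have <- : mu (~` Z) = 1%E by rewrite probability_setC// Z0 sube0.
  apply: le_measure; rewrite ?inE//; first exact: measurableC.
  move=> x Zx /=; have [t yt] : exists t, y <= wavg w T a f t x.
    by apply: contrapT => h; apply: Zx; apply: fZ => /= /(_ y).
  rewrite (le_trans _ (lee_abs _))// (@le_trans _ _ (wavg w T a f t x)%:E)//.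
  by apply: ereal_sup_ubound; exists t.
apply: (@lt_le_trans _ _ y%:E).
  by rewrite lte_fin (le_lt_trans (ler_norm _))// /y ltrDl.
rewrite /weak_Lnorm; apply: ereal_sup_ubound; exists y => //.
by rewrite [X in (_ * X `^ _)%E]muS poweR_EFin powR1 mule1.
Qed.

End weak_type_failure.

Theorem theorem2p4 (R : realType) (d : measure_display) (X : measurableType d)
    (mu : probability X R) (p : R) (w : nat -> R) (T : X -> X) :
  1 <= p ->
  (forall t : nat, 0 < w t) ->
  Cp p w = +oo%E ->
  countably_separated mu ->
  measure_preserving mu T ->
  aperiodic mu T ->
  exists a : nat -> nat,
    ~ maximal_weak_type mu p w T a /\
    exists2 f : X -> R, f \in Lfun mu p%:E &
      {ae mu, forall x : X, ~ cvgn (fun t : nat => wavg w T a f t x)}.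
Proof.
move=> p1 w0 Cw sepX mpT apT.
have [a [f fL fae]] := unbounded_averages p1 w0 Cw sepX mpT apT.
exists a; split.
  apply: unbounded_not_weak_type fL fae; first exact: lt_le_trans ltr01 p1.
  by case: mpT.
exists f => //; apply: filterS fae => x; exact: unbounded_not_cvgn.
Qed.
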